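(* Let $X$ be a $T_D$-space. A closed set $F\subseteq X$ is homogeneous maximal nowhere dense in $X$ if and only if the induced sublocale $\widetilde{F}$ of $\mathfrak{O}X$ is homogeneous maximal nowhere dense in $\mathfrak{O}X$.
   Context: A space $X$ is $T_D$ if every $x\in X$ has an open neighbourhood $U$ such that $U\smallsetminus\{x\}$ is open. $\mathfrak{O}X$ is the locale of open subsets of $X$. For $A\subseteq X$, the induced sublocale is $\widetilde{A}=\{\mathrm{int}((X\smallsetminus A)\cup G):G\in\mathfrak{O}X\}$. Spaces: a subset is nowhere dense if the interior of its closure is empty. A nowhere dense subset $N$ of $X$ is maximal nowhere dense if there is no nowhere dense subset $K$ of $X$ with $N\subseteq K$ such that $N$ is nowhere dense in the subspace $K$. A closed nowhere dense subset $F$ of $X$ is homogeneous maximal nowhere dense if each non-empty regular-closed subset of the subspace $F$ (i.e. closure in $F$ of an open subset of $F$) is maximal nowhere dense in $X$. Locales: a sublocale $N$ of $L$ is nowhere dense if $N\cap\mathfrak{B}L=\{1\}$, where $\mathfrak{B}L=\{x\to 0:x\in L\}$; ''$N$ is nowhere dense in $S$'' means $N\subseteq S$ and $N$ is a nowhere dense sublocale of the locale $S$. A nowhere dense sublocale $N$ of $L$ is maximal nowhere dense if there is no nowhere dense sublocale $S$ of $L$ such that $N$ is nowhere dense in $S$. A regular-closed sublocale of a locale is the closure of some open sublocale. A closed nowhere dense sublocale $N$ of $L$ is homogeneous maximal nowhere dense if each regular-closed sublocale of the locale $N$ different from $\{1\}$ is maximal nowhere dense in $L$. *)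

(* Defs.v *)
From HB Require Import structures.
From mathcomp Require Import all_boot all_order.
From mathcomp Require Import all_classical topology.

Set Implicit Arguments.
Unset Strict Implicit.
Unset Printing Implicit Defensive.

Import Order.TTheory.

Local Open Scope classical_set_scope.

HB.mixin Record TBLattice_isFrame d (T : Type) & Order.TBLattice d T := {
  frame_sup : set T -> T;
  frame_sup_ub : forall (A : set T) (x : T), A x -> (x <= frame_sup A)%O;
  frame_sup_le : forall (A : set T) (y : T),
    (forall x, A x -> (x <= y)%O) -> (frame_sup A <= y)%O;
  meet_frame_sup : forall (a : T) (A : set T),
    (a `&` frame_sup A)%O = frame_sup [set (a `&` b)%O | b in A];
}.

#[short(type="frameType")]
HB.structure Definition Frame d :=
  { T of TBLattice_isFrame d T & Order.TBLattice d T }.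

(* Binary joins, top and bottom are recovered from arbitrary joins. *)
HB.factory Record POrder_isFrame d (T : Type) & Order.POrder d T := {
  meet : T -> T -> T;
  sup : set T -> T;
  meetP : forall x y z : T,
    (x <= meet y z)%O = (x <= y)%O && (x <= z)%O;
  sup_ub : forall (A : set T) (x : T), A x -> (x <= sup A)%O;
  sup_le : forall (A : set T) (y : T),
    (forall x, A x -> (x <= y)%O) -> (sup A <= y)%O;
  meet_sup_le : forall (a : T) (A : set T),
    (meet a (sup A) <= sup (meet a @` A))%O;
}.

HB.builders Context d T & POrder_isFrame d T.

Fact join_subproof (x y z : T) :
  (sup [set x; y] <= z)%O = (x <= z)%O && (y <= z)%O.
Proof.
apply/idP/andP => [xyz|[xz yz]]; last by apply: sup_le => w [] ->.
by split; apply: le_trans xyz; apply: sup_ub; [left|right].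
Qed.

HB.instance Definition _ := @Order.POrder_MeetJoin_isLattice.Build d T
  meet (fun x y => sup [set x; y]) meetP join_subproof.

Fact le0_subproof (x : T) : (sup set0 <= x)%O.
Proof. exact: sup_le. Qed.

Fact le1_subproof (x : T) : (x <= sup setT)%O.
Proof. exact: sup_ub. Qed.

HB.instance Definition _ := @Order.hasBottom.Build d T _ le0_subproof.
HB.instance Definition _ := @Order.hasTop.Build d T _ le1_subproof.

Fact meet_sup_subproof (a : T) (A : set T) :
  (a `&` sup A)%O = sup [set (a `&` b)%O | b in A].
Proof.
apply/eqP; rewrite eq_le meet_sup_le /=.
apply: sup_le => _ [b Ab <-]; apply: leI2 => //; exact: sup_ub.
Qed.

HB.instance Definition _ := @TBLattice_isFrame.Build d T
  sup sup_ub sup_le meet_sup_subproof.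

HB.end.

Section FrameOps.
Context {d : Order.disp_t} {L : frameType d}.
Implicit Types (x y z : L) (A : set L).

Definition frame_inf A : L := frame_sup [set x | forall y, A y -> (x <= y)%O].

Definition frame_imp x y : L := frame_sup [set z | (z `&` x <= y)%O].

Lemma frame_inf_lb A x : A x -> (frame_inf A <= x)%O.
Proof. by move=> Ax; apply: frame_sup_le => y; apply. Qed.

Lemma frame_inf_ge A x : (forall y, A y -> (x <= y)%O) -> (x <= frame_inf A)%O.
Proof. by move=> xA; apply: frame_sup_ub. Qed.

Lemma frame_impP x y z : (z <= frame_imp x y)%O = (z `&` x <= y)%O.
Proof.
apply/idP/idP => [zxy|]; last by move=> ?; apply: frame_sup_ub.
apply: (@le_trans _ _ (frame_imp x y `&` x)%O); first exact: leI2.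
rewrite meetC /frame_imp meet_frame_sup; apply: frame_sup_le => _ [w wxy <-].
by rewrite meetC.
Qed.

End FrameOps.

Definition is_sublocale d (L : frameType d) (S : set L) : Prop :=
  (forall A : set L, A `<=` S -> S (frame_inf A)) /\
  (forall x s : L, S s -> S (frame_imp x s)).

Record sublocale d (L : frameType d) := Sublocale {
  sublocale_set :> set L;
  sublocaleP : is_sublocale sublocale_set
}.

(* A sublocale seen as a locale in its own right, with the inherited order;
   meets and implications agree with those of [L], joins in general do not. *)
Definition locale_of d (L : frameType d) (S : sublocale L) : Type :=
  {x : L | x \in sublocale_set S}.

Section LocaleOf.
Context {d : Order.disp_t} {L : frameType d} (S : sublocale L).

HB.instance Definition _ := SubChoice.copy (locale_of S)
  {x : L | x \in sublocale_set S}.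
HB.instance Definition _ := [SubChoice_isSubPOrder of locale_of S by <: with d].

Definition to_locale_of (x : L) (Sx : sublocale_set S x) : locale_of S :=
  @exist L (fun x => x \in sublocale_set S) x (mem_set Sx).

Lemma locale_of_valP (x : locale_of S) : sublocale_set S (val x).
Proof. exact: set_mem (valP x). Qed.

Fact locale_of_meet_subproof (x y : L) :
  sublocale_set S x -> sublocale_set S y -> sublocale_set S (x `&` y)%O.
Proof.
move=> Sx Sy; suff -> : (x `&` y)%O = frame_inf [set x; y].
  by apply: (sublocaleP S).1 => z [] ->.
apply/le_anti/andP; split.
  by apply: frame_inf_ge => z [] ->; [exact: leIl|exact: leIr].
by rewrite lexI; apply/andP; split; apply: frame_inf_lb; [left|right].
Qed.

Definition locale_of_meet (x y : locale_of S) : locale_of S :=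
  to_locale_of (locale_of_meet_subproof (locale_of_valP x) (locale_of_valP y)).

Fact locale_of_sup_subproof (A : set (locale_of S)) :
  sublocale_set S
    (frame_inf [set s | sublocale_set S s /\ forall x, A x -> (val x <= s)%O]).
Proof. by apply: (sublocaleP S).1 => s []. Qed.

Definition locale_of_sup (A : set (locale_of S)) : locale_of S :=
  to_locale_of (locale_of_sup_subproof A).

Fact locale_of_meetP (x y z : locale_of S) :
  (x <= locale_of_meet y z)%O = (x <= y)%O && (x <= z)%O.
Proof. by rewrite -!Order.le_val /= lexI. Qed.

Fact locale_of_sup_ub (A : set (locale_of S)) x :
  A x -> (x <= locale_of_sup A)%O.
Proof.
by move=> Ax; rewrite -Order.le_val /=; apply: frame_inf_ge => s [_]; apply.
Qed.

Fact locale_of_sup_le (A : set (locale_of S)) y :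
  (forall x, A x -> (x <= y)%O) -> (locale_of_sup A <= y)%O.
Proof.
move=> Ay; rewrite -Order.le_val /=; apply: frame_inf_lb; split.
  exact: locale_of_valP.
by move=> x /Ay; rewrite -Order.le_val.
Qed.

Fact locale_of_meet_sup_le a (A : set (locale_of S)) :
  (locale_of_meet a (locale_of_sup A) <=
   locale_of_sup (locale_of_meet a @` A))%O.
Proof.
rewrite -Order.le_val /= meetC -frame_impP; apply: frame_inf_lb; split.
  by apply: (sublocaleP S).2; exact: locale_of_sup_subproof.
move=> x Ax; rewrite frame_impP meetC.
have /locale_of_sup_ub : (locale_of_meet a @` A) (locale_of_meet a x).
  by exists x.
by rewrite -Order.le_val.
Qed.

HB.instance Definition _ := @POrder_isFrame.Build d (locale_of S)
  locale_of_meet locale_of_sup locale_of_meetP locale_of_sup_ub locale_of_sup_le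
  locale_of_meet_sup_le.

End LocaleOf.

Section Sublocales.
Context {d : Order.disp_t}.
Implicit Types L : frameType d.

Definition booleanization L : set L := [set frame_imp x \bot%O | x in setT].

Definition open_sublocale L (a : L) : set L := [set frame_imp a x | x in setT].

Definition closed_sublocale L (a : L) : set L := [set x | (a <= x)%O].

Definition sublocale_closure L (S : set L) : set L :=
  \bigcap_(a in [set a | S `<=` closed_sublocale a]) closed_sublocale a.

Definition regular_closed_sublocale L (R : set L) : Prop :=
  exists a : L, R = sublocale_closure (open_sublocale a).

Definition nowhere_dense_sublocale L (N : set L) : Prop :=
  is_sublocale N /\ N `&` @booleanization L = [set \top%O].

(* [val @^-1` N] is [N] as a subset of the locale [S]. *)
Definition nowhere_dense_in_sublocale L (N : set L) (S : sublocale L) : Prop :=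
  N `<=` S /\ @nowhere_dense_sublocale (locale_of S) (val @^-1` N).

Definition maximal_nowhere_dense_sublocale L (N : set L) : Prop :=
  nowhere_dense_sublocale N /\
  ~ exists S : sublocale L,
      nowhere_dense_sublocale S /\ nowhere_dense_in_sublocale N S.

Definition homogeneous_maximal_nowhere_dense_sublocale L (N : sublocale L) :
    Prop :=
  [/\ exists a : L, sublocale_set N = closed_sublocale a,
      nowhere_dense_sublocale N &
      forall R : set (locale_of N), regular_closed_sublocale R ->
        R <> [set \top%O] -> maximal_nowhere_dense_sublocale (val @` R)].

End Sublocales.

Definition TD_space (X : topologicalType) : Prop :=
  forall x : X, exists U : set X, [/\ open U, U x & open (U `\ x)].

Definition nowhere_dense (X : topologicalType) (A : set X) : Prop :=
  (closure A)° = set0.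

(* A set [K] coerces to the type of its elements, which carries the subspace
   topology. *)
Definition nowhere_dense_in (X : topologicalType) (N K : set X) : Prop :=
  N `<=` K /\ @nowhere_dense K (set_val @^-1` N).

Definition maximal_nowhere_dense (X : topologicalType) (N : set X) : Prop :=
  nowhere_dense N /\
  ~ exists K : set X, nowhere_dense K /\ nowhere_dense_in N K.

Definition homogeneous_maximal_nowhere_dense (X : topologicalType)
    (F : set X) : Prop :=
  [/\ closed F, nowhere_dense F &
      forall R : set F, (exists U : set F, open U /\ R = closure U) ->
        R !=set0 -> maximal_nowhere_dense (set_val @` R)].

Definition opens (X : topologicalType) : Type := {U : set X | U \in @open X}.

Definition Opens (X : topologicalType) (U : set X) (oU : open U) : opens X :=
  @exist (set X) (fun U => U \in @open X) U (mem_set oU).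

Section OpensFrame.
Context {X : topologicalType}.

HB.instance Definition _ := SubChoice.copy (opens X)
  {U : set X | U \in @open X}.
HB.instance Definition _ :=
  [SubChoice_isSubPOrder of opens X by <: with set_display].

Lemma opens_open (U : opens X) : open (val U).
Proof. exact: set_mem (valP U). Qed.

Lemma opens_le (U V : opens X) : (U <= V)%O <-> val U `<=` val V.
Proof. by rewrite -Order.le_val subsetEset. Qed.

Definition opens_meet (U V : opens X) : opens X :=
  Opens (openI (opens_open U) (opens_open V)).

Fact opens_sup_subproof (A : set (opens X)) : open (\bigcup_(U in A) val U).
Proof. by apply: bigcup_open => U _; exact: opens_open. Qed.

Definition opens_sup (A : set (opens X)) : opens X :=
  Opens (opens_sup_subproof A).

Fact opens_meetP (U V W : opens X) :
  (U <= opens_meet V W)%O = (U <= V)%O && (U <= W)%O.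
Proof.
apply/idP/andP => [/opens_le UVW|[/opens_le UV /opens_le UW]].
  by split; apply/opens_le => x /UVW [].
by apply/opens_le => x Ux; split; [exact: UV|exact: UW].
Qed.

Fact opens_sup_ub (A : set (opens X)) U : A U -> (U <= opens_sup A)%O.
Proof. by move=> AU; apply/opens_le; exact: bigcup_sup. Qed.

Fact opens_sup_le (A : set (opens X)) V :
  (forall U, A U -> (U <= V)%O) -> (opens_sup A <= V)%O.
Proof. by move=> AV; apply/opens_le; apply: bigcup_sub => U /AV /opens_le. Qed.

Fact opens_meet_sup_le U (A : set (opens X)) :
  (opens_meet U (opens_sup A) <= opens_sup (opens_meet U @` A))%O.
Proof.
by apply/opens_le => x [Ux [V AV Vx]]; exists (opens_meet U V) => //; exists V.
Qed.

HB.instance Definition _ := @POrder_isFrame.Build set_display (opens X)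
  opens_meet opens_sup opens_meetP opens_sup_ub opens_sup_le opens_meet_sup_le.

End OpensFrame.

Section InducedSublocale.
Context {X : topologicalType} (A : set X).

Definition induced_sublocale_set : set (opens X) :=
  [set Opens (@open_interior X (~` A `|` val G)) | G in [set: opens X]].

Lemma induced_sublocale_setP (U : opens X) :
  induced_sublocale_set U <-> (~` A `|` val U)° `<=` val U.
Proof.
split=> [[G _ <-] /=|AU]; last first.
  exists U => //; apply/val_inj/seteqP; split=> //=.
  rewrite -open_subsetE; last exact: opens_open.
  by move=> x Ux; right.
apply: interiorS => x [nAx|/interior_subset//]; by left.
Qed.

Fact induced_sublocale_subproof : is_sublocale induced_sublocale_set.
Proof.
split=> [B BA|U V /induced_sublocale_setP AV].
  apply/induced_sublocale_setP.
  pose W := Opens (@open_interior X (~` A `|` val (frame_inf B))).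
  suff /opens_le : (W <= frame_inf B)%O by [].
  apply: frame_inf_ge => U BU; apply/opens_le.
  have /induced_sublocale_setP := BA _ BU; apply: subset_trans.
  apply: interiorS; apply: setUS.
  by have /opens_le := frame_inf_lb BU.
apply/induced_sublocale_setP.
pose W := Opens (@open_interior X (~` A `|` val (frame_imp U V))).
suff /opens_le : (W <= frame_imp U V)%O by [].
have /opens_le UV : (frame_imp U V `&` U <= V)%O by rewrite -frame_impP.
rewrite frame_impP; apply/opens_le/(subset_trans _ AV).
rewrite -open_subsetE; last exact: opens_open.
move=> x [/= /interior_subset [nAx|Wx] Ux]; first by left.
by right; apply: UV; split.
Qed.

Definition induced_sublocale : sublocale (opens X) :=
  Sublocale induced_sublocale_subproof.

End InducedSublocale.

(* Main.v *)
Require Import Defs.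
From HB Require Import structures.
From mathcomp Require Import all_boot all_order.
From mathcomp Require Import all_classical topology.

Import Order.TTheory.

Local Open Scope classical_set_scope.

(* A sublocale [N] is nowhere dense exactly when its least element [n] is dense,
   that is [n -> 0 = 0]. For closed [N] this turns maximal nowhere density into a
   condition on [n] quantifying over dense elements [s <= n] with [n -> s = s].
   In the frame of open sets such an [s] is the complement of a closed nowhere
   dense set containing [N] in which [N] is nowhere dense, so it remains to match
   the regular-closed sublocales of the induced sublocale of [F] with the
   regular-closed subsets of [F]. *)

(** * Nowhere dense and regular-closed sublocales of a frame *)

Section FrameTheory.
Context {d : Order.disp_t} {L : frameType d}.
Implicit Types (a x y : L) (N : set L).

Lemma frame_imp_ge x y : (y <= frame_imp x y)%O.
Proof. by rewrite frame_impP leIl. Qed.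

Lemma frame_inf_closed_sublocale a : frame_inf (closed_sublocale a) = a.
Proof.
apply/le_anti/andP; split; last exact: frame_inf_ge.
by apply: frame_inf_lb; exact: lexx.
Qed.

Lemma closed_sublocaleP a : is_sublocale (closed_sublocale a).
Proof.
split=> [A Aa|x s as_]; first exact: frame_inf_ge.
exact: le_trans as_ (frame_imp_ge _ _).
Qed.

Lemma sublocale_top N : is_sublocale N -> N \top%O.
Proof.
have -> : \top%O = frame_inf (@set0 L).
  by apply/le_anti; rewrite lex1 andbT; apply: frame_inf_ge.
by move=> sN; apply: sN.1.
Qed.

Lemma nowhere_dense_sublocaleP N : is_sublocale N ->
  nowhere_dense_sublocale N <-> frame_imp (frame_inf N) \bot%O = \bot%O.
Proof.
move=> sN; split=> [[_ NB]|n0]; last first.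
  split=> //; apply/seteqP; split=> [_ [/[swap] -[x _ <-] Nx]|_ ->] /=.
    (* A member [x -> 0] of [N] lies above the least element [n], so [x <= n -> 0 = 0] and [x -> 0]
       is top. *)
    have x0 : (x <= \bot)%O.
      rewrite -n0 frame_impP meetC -frame_impP; exact: frame_inf_lb.
    apply/le_anti; rewrite lex1 frame_impP; exact: le_trans (leIr _ _) x0.
  split; first exact: sublocale_top.
  by exists \bot%O => //; apply/le_anti; rewrite lex1 frame_impP leIr.
set n := frame_inf N in NB *.
(* The double pseudocomplement of [n] lies in [N], since it is [n^* -> n]. *)
have nn : frame_imp (frame_imp n \bot%O) \bot%O =
    frame_imp (frame_imp n \bot%O) n.
  apply/le_anti/andP; split.
    rewrite frame_impP; apply: le_trans (le0x n).
    by rewrite -frame_impP.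
  rewrite frame_impP.
  apply: (@le_trans _ _ (frame_imp n \bot%O `&` n)%O); last first.
    by rewrite -frame_impP.
  by rewrite lexI leIr /= -frame_impP.
have : [set \top%O] (frame_imp (frame_imp n \bot%O) \bot%O).
  rewrite -NB; split; last by exists (frame_imp n \bot%O).
  by rewrite nn; apply: sN.2; apply: sN.1.
move=> /= top_; apply/le_anti; rewrite le0x andbT.
have : (\top <= frame_imp (frame_imp n \bot) \bot)%O by rewrite top_.
by rewrite frame_impP meet1x.
Qed.

(** The open sublocale of [a] has least element [a -> 0], and the closure of a set with a least
    element is the up-set of that element. *)
Lemma closure_open_sublocale a :
  sublocale_closure (open_sublocale a) = closed_sublocale (frame_imp a \bot%O).
Proof.
apply/seteqP; split=> [x Cx|x ax b ab].
  apply: Cx => _ [y _ <-]; rewrite /closed_sublocale /= frame_impP.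
  by apply: le_trans (le0x y); rewrite -frame_impP.
by apply: le_trans ax; apply: ab; exists \bot%O.
Qed.

Lemma regular_closed_sublocaleP N :
  regular_closed_sublocale N <->
  exists a, N = closed_sublocale (frame_imp a \bot%O).
Proof. by split=> -[a ->]; exists a; rewrite closure_open_sublocale. Qed.

Lemma closed_sublocale_eq_top a :
  closed_sublocale a = [set \top%O] <-> a = \top%O.
Proof.
split=> [aT|->].
  by have : [set \top%O] a by rewrite -aT; exact: lexx.
by apply/seteqP; split=> [x|_ ->]; rewrite /closed_sublocale /= ?le1x => // /eqP.
Qed.

End FrameTheory.

(** * Nowhere density relative to a sublocale *)

Section LocaleOfTheory.
Context {d : Order.disp_t} {L : frameType d}.
Implicit Types (a f : L) (S : sublocale L).

(** Meets in [S] are those of [L], and [S] is closed under implication, so both sides solve the same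
    adjunction. *)
Lemma val_frame_imp S (x y : locale_of S) :
  val (frame_imp x y) = frame_imp (val x) (val y).
Proof.
have val_meet (u v : locale_of S) : val (u `&` v)%O = (val u `&` val v)%O by [].
have Sxy := (sublocaleP S).2 (val x) _ (locale_of_valP y).
apply/le_anti/andP; split.
  by rewrite frame_impP -val_meet Order.le_val -frame_impP.
have : (to_locale_of Sxy <= frame_imp x y)%O.
  by rewrite frame_impP -Order.le_val val_meet /= -frame_impP.
by rewrite -Order.le_val.
Qed.

Lemma val_locale_of_bot S : val (\bot%O : locale_of S) = frame_inf S.
Proof.
apply/le_anti/andP; split.
  apply: frame_inf_ge => s Ss.
  by have := le0x (to_locale_of Ss); rewrite -Order.le_val.
exact: frame_inf_lb (locale_of_valP _).
Qed.

Lemma val_locale_of_top S : val (\top%O : locale_of S) = \top%O.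
Proof.
have Stop := sublocale_top _ (sublocaleP S).
apply/le_anti; rewrite lex1 /=.
by have := lex1 (to_locale_of Stop); rewrite -Order.le_val.
Qed.

Lemma preimage_val_closed_sublocale S (x : locale_of S) :
  val @^-1` closed_sublocale (val x) = closed_sublocale x.
Proof.
by apply/seteqP; split=> y; rewrite /closed_sublocale /= -Order.le_val.
Qed.

Lemma nowhere_dense_in_closed_sublocale a S :
  nowhere_dense_in_sublocale (closed_sublocale a) S <->
  closed_sublocale a `<=` S /\ frame_imp a (frame_inf S) = frame_inf S.
Proof.
(* Both sides include [closed_sublocale a] in [S], hence [a] is an element of the locale [S] and the
   density criterion applies there. *)
suff nd : sublocale_set S a ->
    nowhere_dense_sublocale (val @^-1` closed_sublocale a : set (locale_of S)) <->
    frame_imp a (frame_inf S) = frame_inf S.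
  split=> -[aS aSE]; split=> //; apply/nd => //; apply: aS; exact: lexx.
move=> Sa; rewrite (preimage_val_closed_sublocale _ (to_locale_of Sa)).
rewrite (nowhere_dense_sublocaleP _ (closed_sublocaleP _)).
rewrite frame_inf_closed_sublocale -val_locale_of_bot -[a]/(val (to_locale_of Sa)).
by rewrite -val_frame_imp; split=> [->|/val_inj].
Qed.

(* Passing from [S] to its closure does not change [frame_inf S], so only closed
   sublocales [S] need to be tested. *)
Lemma maximal_nowhere_dense_closed_sublocale a :
  maximal_nowhere_dense_sublocale (closed_sublocale a) <->
  frame_imp a \bot%O = \bot%O /\
  ~ exists s, [/\ frame_imp s \bot%O = \bot%O, (s <= a)%O & frame_imp a s = s].
Proof.
split=> -[nda maxa]; split.
- move/(nowhere_dense_sublocaleP _ (closed_sublocaleP _)): nda.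
  by rewrite frame_inf_closed_sublocale.
- move=> [s [s0 sa as_]]; apply: maxa.
  exists (Sublocale (closed_sublocaleP s)); split.
    apply/(nowhere_dense_sublocaleP _ (closed_sublocaleP _)).
    by rewrite frame_inf_closed_sublocale.
  apply/nowhere_dense_in_closed_sublocale.
  rewrite frame_inf_closed_sublocale; split=> // x; exact: le_trans.
- apply/(nowhere_dense_sublocaleP _ (closed_sublocaleP _)).
  by rewrite frame_inf_closed_sublocale.
- move=> [S [/(nowhere_dense_sublocaleP _ (sublocaleP S)) ndS]].
  move=> /nowhere_dense_in_closed_sublocale [aS Sa]; apply: maxa.
  exists (frame_inf S); split=> //.
  by apply/frame_inf_lb/aS; exact: lexx.
Qed.

(** Closedness of [S] makes it an up-set, so everything above [val x] in [L] already belongs to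
    [S]. *)
Lemma val_closed_sublocale f S (x : locale_of S) :
  sublocale_set S = closed_sublocale f ->
  val @` closed_sublocale x = closed_sublocale (val x).
Proof.
move=> Sf; apply/seteqP; split=> [_ [y xy <-]|y xy].
  by move: xy; rewrite /closed_sublocale /= -Order.le_val.
have Sy : sublocale_set S y.
  rewrite Sf; apply: le_trans xy.
  have : closed_sublocale f (val x) by rewrite -Sf; exact: locale_of_valP.
  exact.
by exists (to_locale_of Sy) => //; rewrite /closed_sublocale /= -Order.le_val.
Qed.

End LocaleOfTheory.

(** * Implication and induced sublocales in the frame of open sets *)

Section OpensTheory.
Context {X : topologicalType}.
Implicit Types U V : opens X.

Lemma val_opens_imp U V : val (frame_imp U V) = (~` val U `|` val V)°.
Proof.
apply/seteqP; split.
  rewrite -open_subsetE; last exact: opens_open.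
  have /opens_le UV : (frame_imp U V `&` U <= V)%O by rewrite -frame_impP.
  move=> x Wx; have [Ux|nUx] := pselect (val U x); last by left.
  by right; apply: UV.
pose W := Opens (@open_interior X (~` val U `|` val V)).
suff /opens_le : (W <= frame_imp U V)%O by [].
rewrite frame_impP; apply/opens_le => x [/= /interior_subset [nUx|//] Ux].
exact: False_ind (nUx Ux).
Qed.

Lemma val_opens_bot : val (\bot%O : opens X) = set0.
Proof.
apply/seteqP; split=> //.
suff /opens_le : (\bot <= Opens (@open0 X))%O by [].
exact: le0x.
Qed.

Lemma val_opens_top : val (\top%O : opens X) = setT.
Proof.
apply/seteqP; split=> //.
suff /opens_le : (Opens (@openT X) <= \top)%O by [].
exact: lex1.
Qed.

Lemma induced_sublocale_closed (F : set X) (oF : open (~` F)) :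
  sublocale_set (induced_sublocale F) = closed_sublocale (Opens oF).
Proof.
apply/seteqP; split=> [U /induced_sublocale_setP FU|U /opens_le FU].
  apply/opens_le; apply: subset_trans FU => /=.
  by rewrite -open_subsetE// => x; left.
apply/induced_sublocale_setP => x /interior_subset [/FU|] //.
Qed.

Lemma opens_pseudocompl_eq0 {N : set X} (oN : open (~` N)) :
  frame_imp (Opens oN) \bot%O = \bot%O <-> N° = set0.
Proof.
have E : val (frame_imp (Opens oN) \bot%O) = N°.
  by rewrite val_opens_imp val_opens_bot setU0 /= setCK.
split=> [/(congr1 val)|N0]; first by rewrite E val_opens_bot.
by apply: val_inj; rewrite E val_opens_bot.
Qed.

End OpensTheory.

(** * Maximal nowhere dense subsets of a space *)

Section Subspaces.
Context {X : topologicalType}.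
Implicit Types N K : set X.

Lemma closed_nowhere_dense N : closed N -> nowhere_dense N <-> N° = set0.
Proof. by rewrite /nowhere_dense => /closure_id <-. Qed.

Lemma closure_set_val {K} (A : set K) :
  closure A = set_val @^-1` closure (set_val @` A).
Proof.
apply/seteqP; split=> x.
  rewrite /preimage /= !closureEonbhs => Ax C B CA [oB Bx].
  have [|y [Ay By]] := Ax _ (set_val @^-1` B) (fun _ => id).
    by split=> //; exists B.
  by exists (set_val y); split=> //; apply: CA; exists y.
rewrite /preimage /= !closureEonbhs => Ax C _ CA [[B oB <-] Bx].
have [//|_ [[y Ay <-] By]] := Ax _ B (fun _ => id).
by exists y; split=> //; apply: CA.
Qed.

Lemma image_closure_set_val {K} (A : set K) : closed K ->
  set_val @` closure A = closure (set_val @` A).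
Proof.
move=> cK; rewrite closure_set_val; apply/seteqP; split=> [_ [x Ax <-] //|x Ax].
have Kx : K x.
  apply/cK; move: x Ax; apply: closureS => _ [y _ <-]; exact: set_valP.
by exists (exist _ x (mem_set Kx)).
Qed.

(** Open sets of the subspace [K] are the traces of open sets [W] of [X]; this removes the subtype
    from the condition. *)
Lemma nowhere_dense_inP N K : N `<=` K ->
  nowhere_dense_in N K <->
  forall W, open W -> W `&` K `<=` closure N -> W `&` K = set0.
Proof.
move=> NK; rewrite /nowhere_dense_in /nowhere_dense closure_set_val.
have -> : set_val @` (set_val @^-1` N : set K) = N.
  apply/seteqP; split=> [_ [x Nx <-] //|x Nx].
  by exists (exist _ x (mem_set (NK _ Nx))).
split=> [[_ N0] W oW WKN|KN].
  apply/seteqP; split=> // x [Wx Kx].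
  suff : (set_val @^-1` closure N : set K)° (exist _ x (mem_set Kx)).
    by rewrite N0.
  have : (set_val @^-1` W : set K) `<=` (set_val @^-1` closure N)°.
    rewrite -open_subsetE; last by exists W.
    by move=> y Wy; apply: WKN; split=> //; exact: set_valP.
  exact.
split=> //; have [W oW We] := @open_interior K (set_val @^-1` closure N).
apply/seteqP; split=> // x; rewrite -We => Wx.
suff : (W `&` K) (set_val x) by rewrite KN// => y [Wy Ky];
  have : (set_val @^-1` W : set K) (exist _ y (mem_set Ky)) by [];
  rewrite We => /interior_subset.
by split=> //; exact: set_valP.
Qed.

(* The closure of a nowhere dense [K] is nowhere dense, and [N] remains nowhere
   dense in it, so only closed [K] need to be tested. *)
Lemma closed_maximal_nowhere_dense N : closed N ->
  maximal_nowhere_dense N <->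
  N° = set0 /\
  ~ exists K, [/\ closed K, K° = set0, N `<=` K & (N `|` ~` K)° `<=` ~` K].
Proof.
move=> cN.
(* The interior on the left is the largest open set whose trace on [K] lies in [N], so testing it
   alone suffices. *)
have inP K : N `<=` K -> nowhere_dense_in N K <-> (N `|` ~` K)° `<=` ~` K.
  move=> NK; rewrite nowhere_dense_inP// -(iffLR (closure_id N) cN).
  split=> [KN x NKx Kx|NK0 W oW WKN].
    have : ((N `|` ~` K)° `&` K) x by [].
    by rewrite (KN _ (open_interior _))// => y [/interior_subset []].
  apply/seteqP; split=> // x [Wx Kx]; apply: (NK0 x) => //.
  suff : W `<=` (N `|` ~` K)° by exact.
  rewrite -open_subsetE// => y Wy.
  by have [Ky|nKy] := pselect (K y); [left; apply: WKN|right].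
rewrite /maximal_nowhere_dense closed_nowhere_dense//.
split=> -[N0 maxN]; split=> //.
  move=> [K [cK K0 NK]] /(inP _ NK) ndNK; apply: maxN.
  by exists K; split=> //; apply/closed_nowhere_dense.
move=> [K [ndK ndNK]]; apply: maxN.
have NK := ndNK.1.
exists (closure K); split=> //; first exact: closed_closure.
  exact: subset_trans NK (@subset_closure _ K).
have /inP := ndNK => /(_ NK) NK0.
(* [W] is open and misses [K], hence it misses the closure of [K]. *)
set W := (_ `|` _)°; have oW : open W by exact: open_interior.
have WK : W `<=` ~` K.
  apply: subset_trans NK0; apply: interiorS; apply: setUS.
  by apply: subsetC; exact: subset_closure.
rewrite -interiorC -open_subsetE//.
Qed.

(** Complementation exchanges the witnesses [K] and [s]: with [a] the complement of [N], the last
    condition on [K] becomes [a -> s <= s]. *)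
Lemma maximal_nowhere_dense_closed_sublocaleP {N} (oN : open (~` N)) :
  maximal_nowhere_dense N <->
  maximal_nowhere_dense_sublocale (closed_sublocale (Opens oN)).
Proof.
rewrite closed_maximal_nowhere_dense -?openC//.
rewrite maximal_nowhere_dense_closed_sublocale opens_pseudocompl_eq0.
split=> -[N0 maxN]; split=> //.
  move=> [s [s0 /opens_le /= sN Ns]]; apply: maxN; exists (~` val s); split.
  - by rewrite closedC; exact: opens_open.
  - have := congr1 val s0.
    by rewrite val_opens_imp val_opens_bot setU0.
  - by rewrite -[N]setCK; apply: subsetC.
  - by rewrite setCK -{2}Ns val_opens_imp /= setCK.
move=> [K [cK K0 NK NK0]]; apply: maxN.
have oK : open (~` K) by rewrite openC.
exists (Opens oK); split; first exact/opens_pseudocompl_eq0.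
  by apply/opens_le; apply: subsetC.
apply/le_anti; rewrite frame_imp_ge andbT; apply/opens_le.
by rewrite val_opens_imp /= setCK.
Qed.

End Subspaces.

(** * Regular-closed subsets of [F] against regular-closed sublocales of its induced sublocale *)

Theorem proposition3p6 (X : topologicalType) (hX : TD_space X)
    (F : set X) (hF : closed F) :
  homogeneous_maximal_nowhere_dense F <->
  homogeneous_maximal_nowhere_dense_sublocale (induced_sublocale F).
Proof.
have oF : open (~` F) by rewrite openC.
pose Ft := induced_sublocale F.
have FtE : sublocale_set Ft = closed_sublocale (Opens oF).
  exact: induced_sublocale_closed.
have inf_Ft : frame_inf Ft = Opens oF by rewrite FtE frame_inf_closed_sublocale.
have ndF : nowhere_dense F <-> nowhere_dense_sublocale Ft.
  rewrite closed_nowhere_dense// (nowhere_dense_sublocaleP _ (sublocaleP Ft)).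
  by rewrite inf_Ft opens_pseudocompl_eq0.
have clF (U : set F) : open (~` (set_val @` closure U)).
  by rewrite openC image_closure_set_val//; exact: closed_closure.
(* Regular-closed sublocales are closures of open ones, hence given by
   pseudocomplements, here those of the locale [Ft]. *)
have pcF (U : set F) (a : locale_of Ft) : val (val a) `&` F = set_val @` U ->
    val (frame_imp a \bot%O) = Opens (clF U).
  move=> aU; apply: val_inj.
  (* The bottom of [Ft] is the complement of [F], so the pseudocomplement of [a] is the complement
     of the closure of the trace of [a] on [F]. *)
  rewrite val_frame_imp val_locale_of_bot inf_Ft val_opens_imp /=.
  by rewrite image_closure_set_val// -aU -setCI interiorC.
have image_eq0 (U : set F) (a : locale_of Ft) :
    val (frame_imp a \bot%O) = Opens (clF U) ->
    closure U = set0 <-> frame_imp a \bot%O = \top%O.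
  move=> aU; split=> [U0|aT].
    apply: val_inj; rewrite aU val_locale_of_top; apply: val_inj.
    by rewrite val_opens_top /= U0 image_set0 setC0.
  have : ~` (set_val @` closure U) = setT.
    by rewrite -val_opens_top -(val_locale_of_top Ft) -aT aU.
  by rewrite -setC0 => /setC_inj /image_set0_set0.
split=> -[_ ndF' maxF].
  split; [by exists (Opens oF)|exact/ndF|].
  move=> R /regular_closed_sublocaleP [a ->{R}] aT.
  pose U : set F := set_val @^-1` val (val a).
  have aU : val (val a) `&` F = set_val @` U.
    apply/seteqP; split=> [x [ax Fx]|_ [x ax <-]].
      by exists (exist _ x (mem_set Fx)).
    by split=> //; exact: set_valP.
  rewrite (val_closed_sublocale _ _ _ FtE) (pcF _ _ aU).
  apply/maximal_nowhere_dense_closed_sublocaleP/maxF.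
    by exists U; split=> //; exists (val (val a)) => //; exact: opens_open.
  apply/set0P/eqP => /(image_eq0 _ _ (pcF _ _ aU)) a1.
  by apply: aT; rewrite closed_sublocale_eq_top.
split=> //; first exact/ndF.
move=> R [U [[G oG GU] ->{R}]] U0.
apply/(maximal_nowhere_dense_closed_sublocaleP (clF U)).
(* Members of [Ft] are the open sets containing the complement of [F]; adding it to [G] gives one
   without changing the trace on [F]. *)
have oGF : open (G `|` ~` F) by exact: openU.
have FtG : sublocale_set Ft (Opens oGF).
  by rewrite FtE; apply/opens_le => x; right.
have aU : val (val (to_locale_of FtG)) `&` F = set_val @` U.
  rewrite -GU; apply/seteqP; split=> [x [[Gx|nFx] Fx] //|_ [x Gx <-]].
    by exists (exist _ x (mem_set Fx)).
  by split; [left|exact: set_valP].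
rewrite -(pcF _ _ aU) -(val_closed_sublocale _ _ _ FtE).
apply: maxF; first by apply/regular_closed_sublocaleP; exists (to_locale_of FtG).
rewrite closed_sublocale_eq_top => /(image_eq0 _ _ (pcF _ _ aU)) U1.
by move: U0; rewrite U1 => -[].
Qed.
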